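(* Suppose there is an algorithm that computes an $(\alpha,\beta)$-stretch spanner with hereditary density $\delta$ in $O(T)$ rounds in the $\mathcal{LOCAL}$ model, and suppose there is an $(\alpha',\beta')$-simulator. Then these can be combined into an $\left(\alpha\delta,\;T\alpha'+\beta'+\delta\log n+\delta\beta\right)$-simulator, where $n$ is the number of nodes.
   Context: $\mathcal{LOCAL}$ model: synchronous rounds; each node does arbitrary local computation and exchanges unbounded-size messages with all neighbors in every round. $\mathcal{GOSSIP}$ model: synchronous rounds; each node may initiate a bidirectional communication with at most one neighbor per round, and the endpoints of each initiated communication exchange unbounded-size messages. An $(\alpha,\beta)$-simulator is a way to transform any algorithm $A$ in the $\mathcal{LOCAL}$ model into an algorithm $A'$ in the $\mathcal{GOSSIP}$ model such that $A'$ computes the same output as $A$ and, if $A$ takes $O(T)$ rounds, then $A'$ takes at most $O(\alpha T+\beta)$ rounds. A subgraph $S=(V,E')$ of $G=(V,E)$ is an $(\alpha,\beta)$-stretch spanner if any two nodes at distance $d$ in $G$ have distance at most $\alpha d+\beta$ in $S$. The hereditary density of a graph is the minimal integer $\delta$ such that every induced subgraph on a node set $S$ has at most $\delta|S|$ edges. *)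

(* Defs.v *)
From mathcomp Require Import all_boot all_order all_algebra.
Set Implicit Arguments.
Unset Strict Implicit.
Unset Printing Implicit Defensive.

Definition edges_in (V : finType) (e : rel V) (A : {set V}) : {set {set V}} :=
  [set [set p.1; p.2] | p in setX A A & e p.1 p.2].

Definition density_bound (V : finType) (e : rel V) (d : nat) : bool :=
  [forall A : {set V}, (#|edges_in e A| <= d * #|A|)%N].

Lemma density_bound_ex (V : finType) (e : rel V) :
  exists d, density_bound e d.
Proof.
exists #|{set V}|; apply/forallP => A.
have [->|/set0Pn[x xA]] := eqVneq A set0.
  rewrite cards0 muln0 leqn0 cards_eq0 -subset0.
  by apply/subsetP => B /imsetP[p]; rewrite !inE.
apply: leq_trans (max_card _) _; rewrite leq_pmulr // card_gt0.
by apply/set0Pn; exists x.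
Qed.

Definition hereditary_density (V : finType) (e : rel V) : nat :=
  ex_minn (density_bound_ex e).

(* Imported only here: the sets above are those of finset, whose notations
   classical_sets shadows. *)
From mathcomp Require Import all_classical all_reals all_analysis.
Import Order.TTheory GRing.Theory Num.Theory.
Import numFieldNormedType.Exports.
Local Open Scope classical_set_scope.
Local Open Scope ring_scope.

Definition walk (V : finType) (e : rel V) (x y : V) (d : nat) : Prop :=
  exists p : seq V, [/\ path e x p, last x p = y & size p = d].

(* Undefined (no [d]) when [x] and [y] are disconnected. *)
Definition at_distance (V : finType) (e : rel V) (x y : V) (d : nat) : Prop :=
  walk e x y d /\ forall k, walk e x y k -> (d <= k)%N.

Definition subgraph (V : finType) (s e : rel V) : Prop :=
  symmetric s /\ subrel s e.

Definition stretch_spanner (R : realType) (V : finType) (alpha beta : R)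
    (s e : rel V) : Prop :=
  subgraph s e /\
  forall (x y : V) (d : nat), at_distance e x y d ->
    exists2 k, at_distance s x y k & k%:R <= alpha * d%:R + beta.

(* A simple graph whose nodes carry pairwise distinct identifiers and, for
   problems with inputs, a local input. *)
Record network (I : Type) := Network {
  node :> finType;
  link : rel node;
  link_sym : symmetric link;
  link_irr : irreflexive link;
  uid : node -> nat;
  uid_inj : injective uid;
  input : node -> I
}.

(* What a node knows before the first round: the number of nodes, its own
   identifier, those of its neighbors, and its input.  The neighbor list is
   sorted so that its order carries no information. *)
Record view (I : Type) := View {
  view_size : nat;
  view_uid : nat;
  view_nbrs : seq nat;
  view_input : I
}.

Definition initial_view (I : Type) (N : network I) (v : N) : view I :=
  View #|N| (uid v) (sort leq [seq uid u | u in link v]) (input v).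

(* A deterministic distributed algorithm with inputs in [I] and outputs in
   [O].  Local computation is any function and messages live in any type.
   [send s i] is the message for neighbor [i]; in [recv s m], [m i] is the
   message obtained from [i] in this round, if any. *)
Record local_algorithm (I O : Type) := LocalAlgorithm {
  state : Type;
  msg : Type;
  init : view I -> state;
  send : state -> nat -> msg;
  recv : state -> (nat -> option msg) -> state;
  out : state -> option O
}.

(* In addition, each node names at most one neighbor to contact per round. *)
Record gossip_algorithm (I O : Type) := GossipAlgorithm {
  gossip_base :> local_algorithm I O;
  contact : state gossip_base -> option nat
}.

Section Execution.
Variables (I O : Type) (A : local_algorithm I O) (N : network I).

(* [c s u v]: in a round entered with states [s], [u] and [v] exchange
   messages. *)
Variable c : (N -> state A) -> rel N.

Definition inbox (s : N -> state A) (v : N) : nat -> option (msg A) :=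
  fun i => omap (fun u => send (s u) (uid v))
                [pick u : N | c s v u && (uid u == i)].

Definition exec_round (s : N -> state A) : N -> state A :=
  fun v => recv (s v) (inbox s v).

Definition exec (t : nat) : N -> state A :=
  iter t exec_round (fun v => init A (initial_view v)).

End Execution.

Definition local_comm (I O : Type) (A : local_algorithm I O) (N : network I)
    (s : N -> state A) : rel N := @link I N.

Definition gossip_comm (I O : Type) (A : gossip_algorithm I O) (N : network I)
    (s : N -> state A) : rel N :=
  fun u v => link u v &&
    ((contact (s u) == Some (uid v)) || (contact (s v) == Some (uid u))).

(* The output register of every node after every number of rounds. *)
Definition behavior (I O : Type) := forall N : network I, N -> nat -> option O.

Definition local_run (I O : Type) (A : local_algorithm I O) : behavior I O :=
  fun N v t => out (exec (@local_comm I O A N) t v).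

Definition gossip_run (I O : Type) (A : gossip_algorithm I O) : behavior I O :=
  fun N v t => out (exec (@gossip_comm I O A N) t v).

(* The first value written is the output; later ones are ignored.  A node
   keeps communicating after it has decided. *)
Definition outputs (I O : Type) (B : behavior I O) (N : network I) (v : N)
    (o : O) : Prop :=
  exists2 t, B N v t = Some o & forall s, (s < t)%N -> B N v s = None.

Definition same_output (I O : Type) (B B' : behavior I O) : Prop :=
  forall (N : network I) (v : N) (o : O), outputs B v o <-> outputs B' v o.

(* [r n] bounds the number of rounds on all [n]-node networks. *)
Definition takes_bigO_rounds (R : realType) (I O : Type) (B : behavior I O)
    (T : nat -> R) : Prop :=
  exists2 r : nat -> nat,
    (fun n => (r n)%:R : R) =O_\oo T
  & forall (N : network I) (v : N), exists2 t, (t <= r #|N|)%N & B N v t.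

(* All parameters are functions of the number of nodes. *)
Definition simulator (R : realType) (alpha beta : nat -> R)
    (F : forall I O : Type, local_algorithm I O -> gossip_algorithm I O)
    : Prop :=
  forall (I O : Type) (A : local_algorithm I O),
    same_output (local_run A) (gossip_run (F I O A)) /\
    forall T : nat -> R, (forall n, 0 <= T n) ->
      takes_bigO_rounds (local_run A) T ->
      takes_bigO_rounds (gossip_run (F I O A))
        (fun n => alpha n * T n + beta n).

(* Every node outputs which identifiers belong to its neighbors in the
   subgraph [s]. *)
Definition computes_spanner (R : realType) (alpha beta : nat -> R)
    (delta : nat -> nat) (A : local_algorithm unit (nat -> bool)) : Prop :=
  forall N : network unit, exists s : rel N,
    [/\ forall v, exists2 o, outputs (local_run A) v o &
          forall u : N, o (uid u) = s v u,
        stretch_spanner (alpha #|N|) (beta #|N|) s (@link unit N)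
      & (hereditary_density s <= delta #|N|)%N].

(* Main.v *)
(* Every node first runs the simulated spanner algorithm for [r n] rounds.  Let
   [K = 4 * delta].  A node that sees at most [K] spanner neighbors not known to
   have settled settles itself and targets exactly those; from then on it
   contacts its targets cyclically.  By the density bound at most half of the
   unsettled nodes have more than [K] unsettled spanner neighbors, so the number
   of unsettled nodes halves every [K] rounds and all are settled after
   [O(delta * log n)] rounds.  Each spanner edge is then used at least once
   every [K] rounds, so [K * (alpha * t + beta)] further rounds flood the initial
   views over all pairs at distance at most [t], and the radius-[t] ball of
   initial views determines the state of a node after [t] LOCAL rounds. *)

Require Import Defs.
From mathcomp Require Import all_boot all_order all_algebra.
From mathcomp Require Import zify boolp.
Set Implicit Arguments.
Unset Strict Implicit.
Unset Printing Implicit Defensive.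

(** * Degree counting under a density bound *)

Section Density.
Variables (V : finType) (e : rel V).

Lemma hereditary_densityP (S : {set V}) d :
  hereditary_density e <= d -> #|edges_in e S| <= d * #|S|.
Proof.
rewrite /hereditary_density; case: ex_minnP => m /forallP/(_ S) h _ le_md.
by apply: leq_trans h _; rewrite leq_mul2r le_md orbT.
Qed.

(** An edge comes from at most two ordered pairs: [f] sends a pair to its edge together with an
    orientation bit, and it is injective. *)
Lemma sum_degree_le (S : {set V}) :
  \sum_(v in S) #|[set u in S | e v u]| <= 2 * #|edges_in e S|.
Proof.
set P := [set p in setX S S | e p.1 p.2].
have -> : \sum_(v in S) #|[set u in S | e v u]| = #|P|.
  rewrite -[RHS]sum1_card (eq_bigl (fun p => (p.1 \in S) &&
    ((p.2 \in S) && e p.1 p.2))); last by move=> p; rewrite !inE andbA.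
  rewrite -(pair_big_dep (fun v => v \in S) (fun v u => (u \in S) && e v u)
    (fun _ _ => 1)) /=.
  by apply: eq_bigr => v _; rewrite -sum1_card; apply: eq_bigl => u; rewrite inE.
pose f (p : V * V) := ([set p.1; p.2], enum_rank p.1 <= enum_rank p.2).
have f_inj : injective f.
  move=> [a b] [c d] [/setP eqs le_eq].
  have mem x : (x == a) || (x == b) = (x == c) || (x == d).
    by have := eqs x; rewrite !inE.
  have [eac|nac] := eqVneq a c.
    subst c; have [->//|nbd] := eqVneq b d.
    have := mem d; rewrite eqxx orbT [d == b]eq_sym (negbTE nbd) orbF => /eqP eda.
    by have := mem b; rewrite eqxx orbT (negbTE nbd) orbF -eda (negbTE nbd).
  have := mem a; rewrite eqxx (negbTE nac) /= => /esym/eqP ead.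
  have := mem c; rewrite eqxx [c == a]eq_sym (negbTE nac) /= => /eqP ecb.
  (* Only the reversed pair is left; equal bits then force equal ranks, so the pair is a loop. *)
  subst d; subst c; have := leq_total (enum_rank a) (enum_rank b).
  rewrite le_eq orbb => le_ba.
  have /eqP/val_inj/enum_rank_inj -> // : enum_rank a == enum_rank b :> nat.
  by rewrite eqn_leq le_eq le_ba.
rewrite -(card_imset _ f_inj).
have -> : 2 * #|edges_in e S| = #|setX (edges_in e S) [set: bool]|.
  by rewrite cardsX cardsT card_bool mulnC.
apply/subset_leq_card/subsetP => _ /imsetP[p pP ->]; rewrite !inE andbT.
by apply/imsetP; exists p.
Qed.

(** Markov's inequality: the degrees within [S] sum to at most [2 * d * #|S|]. The strict threshold
    also covers [d = 0]. *)
Lemma few_high_degree d (S : {set V}) : hereditary_density e <= d ->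
  2 * #|[set v in S | 4 * d < #|[set u in S | e v u]|]| <= #|S|.
Proof.
move=> /(hereditary_densityP S) le_d; have := sum_degree_le S.
set H := [set v in S | _] => sum_le.
have : #|H| * (4 * d).+1 <= \sum_(v in S) #|[set u in S | e v u]|.
  rewrite (bigID (fun v => v \in H)) /= -sum_nat_const.
  apply: leq_trans (leq_addr _ _).
  rewrite [leqRHS](eq_bigl (fun v => v \in H)); last first.
    by move=> v; rewrite /H !inE; case: (v \in S).
  by apply: leq_sum => v; rewrite inE => /andP[].
nia.
Qed.

End Density.

(** * Rounds, inboxes and first outputs *)

Section Execution.
Variables (I O : Type) (A : local_algorithm I O) (N : network I).
Variable c : (N -> state A) -> rel N.

Lemma execS t (v : N) :
  exec c t.+1 v = recv (exec c t v) (inbox c (exec c t) v).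
Proof. by []. Qed.

Lemma inbox_comm (s : N -> state A) (u v : N) :
  c s v u -> inbox c s v (uid u) = Some (send (s u) (uid v)).
Proof.
rewrite /inbox => cvu; case: pickP => [x /andP[_ /eqP/uid_inj ->] //|/(_ u)].
by rewrite cvu eqxx.
Qed.

Lemma inbox_Some (s : N -> state A) (v : N) i m : inbox c s v i = Some m ->
  exists u, [/\ c s v u, uid u = i & m = send (s u) (uid v)].
Proof.
rewrite /inbox; case: pickP => //= u /andP[cvu /eqP ui] [<-]; by exists u.
Qed.

End Execution.

Lemma mem_view_nbrs (I : Type) (N : network I) (v : N) (i : nat) :
  reflect (exists2 u, link v u & uid u = i) (i \in view_nbrs (initial_view v)).
Proof.
rewrite /= mem_sort; apply: (iffP mapP) => [[u uv ->]|[u uv <-]].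
  by exists u => //; rewrite mem_enum in uv.
by exists u => //; rewrite mem_enum.
Qed.

Lemma outputs_uniq (I O : Type) (B : behavior I O) (N : network I) (v : N) o o' :
  outputs B v o -> outputs B v o' -> o = o'.
Proof.
move=> [t Bt mint] [t' Bt' mint'].
have [/mint'|/mint|tt'] := ltngtP t t'; rewrite ?Bt ?Bt' //.
by move: Bt; rewrite tt' Bt' => -[].
Qed.

Lemma outputs_ex (I O : Type) (B : behavior I O) (N : network I) (v : N) t :
  B N v t -> exists2 o, outputs B v o &
  exists2 t', t' <= t & B N v t' = Some o.
Proof.
move=> Bt; have ext : exists t, isSome (B N v t) by exists t.
case: (ex_minnP ext) => t'; case E: (B N v t') => [o|//] _ mint.
exists o; last by exists t' => //; exact: mint.
exists t' => // s st; case E': (B N v s) => [o'|//].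
by have := mint s; rewrite E' leqNgt st => /(_ isT).
Qed.

(** * Locality of LOCAL runs *)

Section Locality.
Variable I : Type.

(** These are the networks that a node holding the views [known] cannot rule out. *)
Definition consistent (known : view I -> Prop) (N : network I) : Prop :=
  forall w, known w -> exists v : N, initial_view v = w.

(** Induction on [t]. Each neighbor of [v] has a known view, which therefore occurs in [N'], and by
    uniqueness of identifiers it occurs at the matching neighbor of [v']. *)
Lemma exec_local (O : Type) (A : local_algorithm I O) known (N N' : network I)
    t (v : N) (v' : N') :
  consistent known N' -> initial_view v = initial_view v' ->
  (forall u k, walk (@link I N) v u k -> k <= t -> known (initial_view u)) ->
  exec (@local_comm I O A N) t v = exec (@local_comm I O A N') t v'.
Proof.
move=> cons; elim: t v v' => [|t IH] v v' vv' ball; first by rewrite /exec /= vv'.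
have uid_v : uid v = uid v' by case: vv'.
have nbr i := mem_view_nbrs v i; have nbr' i := mem_view_nbrs v' i.
rewrite vv' in nbr; rewrite !execS; congr recv.
  by apply: IH => // u k w kt; apply: ball w _; exact: leq_trans kt _.
apply: funext => i; rewrite /inbox.
case: pickP => [u /andP[vu /eqP ui]|nou]; last first.
  case: pickP => [u /andP[vu /eqP ui]|//].
  have /nbr[x vx xi] : i \in view_nbrs (initial_view v') by apply/nbr'; exists u.
  by have := nou x; rewrite /local_comm vx xi eqxx.
have /nbr'[x vx xi] : i \in view_nbrs (initial_view v') by apply/nbr; exists u.
case: pickP => [u' /andP[vu' /eqP ui']|/(_ x)]; last first.
  by rewrite /local_comm vx xi eqxx.
rewrite /= uid_v; congr (Some (send _ _)).
have [|y yu] := cons (initial_view u).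
  by apply: (ball u 1) => //; exists [:: u]; split=> //=; rewrite andbT.
have yu' : y = u'.
  apply: uid_inj; rewrite ui' -ui.
  by case: yu.
apply: IH => [|z k [p [pu pz pk]] kt]; first by rewrite -yu yu'.
apply: (ball z k.+1) => //; exists (u :: p); split=> //=; last by rewrite pk.
by rewrite pu andbT.
Qed.

(* Classical choice lets a node output whatever its knowledge forces, so LOCAL
   states are never recomputed explicitly. *)
Definition known_output (O : Type) (A : local_algorithm I O)
    (known : view I -> Prop) (i : nat) : option O :=
  if pselect (exists o, forall (N : network I) (v : N), consistent known N ->
                uid v = i -> outputs (local_run A) v o) is left h
  then Some (projT1 (cid h)) else None.

Lemma known_output_sound O (A : local_algorithm I O) known (N : network I)
    (v : N) o : consistent known N -> known_output A known (uid v) = Some o ->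
  outputs (local_run A) v o.
Proof.
rewrite /known_output => cons; case: pselect => // h [<-].
by case: (cid h) => /= o' ho; exact: ho.
Qed.

(** In every consistent network the node with this identifier has the same run up to round [t],
    hence the same first output; so knowing the ball forces an output. *)
Lemma known_output_complete O (A : local_algorithm I O) known (N : network I)
    (v : N) o t :
  local_run A v t = Some o ->
  (forall u k, walk (@link I N) v u k -> k <= t -> known (initial_view u)) ->
  known_output A known (uid v).
Proof.
move=> run ball; rewrite /known_output; case: pselect => // -[].
have [|o' out_o' _] := @outputs_ex I O (local_run A) N v t; first by rewrite run.
exists o' => N' v' cons uid_v'.
have vv' : initial_view v = initial_view v'.
  have [|y yv] := cons (initial_view v).
    by apply: (ball v 0) => //; exists [::].
  by rewrite -yv; congr initial_view; apply: uid_inj; rewrite uid_v'; case: yv.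
have eq_run k : k <= t -> local_run A v k = local_run A v' k.
  move=> kt; rewrite /local_run (exec_local A cons vv') // => u j w jk.
  by apply: ball w _; exact: leq_trans jk kt.
case: out_o' => t' run' min'.
have t't : t' <= t by rewrite leqNgt; apply/negP => /min'; rewrite run.
exists t'; first by rewrite -eq_run.
by move=> s st; rewrite -eq_run ?min' //; lia.
Qed.

End Locality.

(** * The simulating GOSSIP algorithm *)

Definition forget_view (I : Type) (w : view I) : view unit :=
  View (view_size w) (view_uid w) (view_nbrs w) tt.

Definition forget_input (I : Type) (N : network I) : network unit :=
  Network (@link_sym I N) (@link_irr I N) (@uid_inj I N) (fun _ => tt).

Section Simulator.
Variables (B : gossip_algorithm unit (nat -> bool)) (r K : nat -> nat).
Variables (I O : Type) (A : local_algorithm I O).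

(* A node settles by fixing its [targets], the spanner neighbors it contacts
   cyclically from then on; [settled] are the identifiers of the neighbors
   known to have settled. *)
Record sim_state := SimState {
  clock : nat;
  self : view I;
  base : state B;
  spanner : option (nat -> bool);
  known : view I -> Prop;
  settled : nat -> bool;
  targets : option (seq nat)
}.

Record sim_msg := SimMsg {
  base_msg : msg B;
  known_msg : view I -> Prop;
  settled_msg : bool
}.

Definition sim_init (w : view I) : sim_state :=
  let b := init B (forget_view w) in
  SimState 0 w b (out b) (fun w' => w' = w) (fun _ => false) None.

Definition sim_send (x : sim_state) (i : nat) : sim_msg :=
  SimMsg (send (base x) i) (known x) (isSome (targets x)).

Definition sim_recv (x : sim_state) (m : nat -> option sim_msg) : sim_state :=
  let b := recv (base x) (fun i => omap base_msg (m i)) in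
  let n := view_size (self x) in
  let done i := settled x i || oapp settled_msg false (m i) in
  let pending := [seq i <- view_nbrs (self x) |
    oapp (fun f => f i) false (spanner x) && ~~ done i] in
  SimState (clock x).+1 (self x) b
    (* Only the first value written by the base algorithm is kept, in line with [outputs]. *)
    (if spanner x is Some f then Some f else out b)
    (fun w => known x w \/ exists i y, m i = Some y /\ known_msg y w)
    done
    (if targets x is Some l then Some l else
     if (r n <= clock x) && (size pending <= K n) then Some pending else None).

(** If [K n] is 0, target lists are empty, so the second phase makes no contact whatever the
    remainder is. *)
Definition sim_contact (x : sim_state) : option nat :=
  let n := view_size (self x) in
  if clock x < r n then contact (base x)
  else obind (fun l => onth l ((clock x - r n) %% K n)) (targets x).

Definition sim : gossip_algorithm I O :=
  @GossipAlgorithm I O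
    (LocalAlgorithm sim_init sim_send sim_recv
      (fun x => known_output A (known x) (view_uid (self x))))
    sim_contact.

End Simulator.

(** * The simulated spanner phase *)

Section Run.
Variables (B : gossip_algorithm unit (nat -> bool)) (r delta : nat -> nat).
Let K n := 4 * delta n.
Variables (I O : Type) (A : local_algorithm I O) (N : network I) (s : rel N).
Let n := #|N|.
Hypothesis s_sym : symmetric s.
Hypothesis s_link : subrel s (@link I N).
Hypothesis s_density : hereditary_density s <= delta n.
Hypothesis B_spanner : forall v : N,
  exists2 o, @outputs _ _ (gossip_run B) (forget_input N) v o &
    forall u, o (uid u) = s v u.
Hypothesis B_rounds : forall v : N,
  exists2 t, t <= r n & @gossip_run _ _ B (forget_input N) v t.

Let F := sim B r K A.
Let st c := exec (@gossip_comm I O F N) c.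

Let comm c := gossip_comm (st c).

Lemma self_st c v : self (st c v) = initial_view v.
Proof. by elim: c v => [|c IH] v //; rewrite /st execS /= IH. Qed.

Lemma clock_st c v : clock (st c v) = c.
Proof. by elim: c v => [|c IH] v //; rewrite /st execS /= IH. Qed.

Lemma contact_st c v : contact (st c v) =
  if c < r n then contact (base (st c v))
  else obind (fun l => onth l ((c - r n) %% K n)) (targets (st c v)).
Proof. by rewrite /= /sim_contact clock_st self_st. Qed.

Lemma comm_sym c : symmetric (comm c).
Proof. by move=> u v; rewrite /comm /gossip_comm link_sym orbC. Qed.

(** Before round [r n] contacts are chosen by [B] alone, so both runs have the same communication
    graphs. *)
Lemma base_st c v : c <= r n ->
  base (st c v) = exec (@gossip_comm _ _ B (forget_input N)) c v.
Proof.
elim: c v => [|c IH] v cr //.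
rewrite /st !execS /=; congr recv; first by apply: IH; exact: ltnW.
apply: funext => i; rewrite /inbox.
have IHc u : base (st c u) = exec (@gossip_comm _ _ B (forget_input N)) c u.
  by apply: IH; exact: ltnW.
rewrite (@eq_pick _ _ (fun u => gossip_comm (A := B) (N := forget_input N)
  (exec (@gossip_comm _ _ B (forget_input N)) c) v u && (uid u == i)));
  last first.
  by move=> u; rewrite /= /gossip_comm !contact_st cr !IHc.
by case: pickP => //= u _; rewrite -IHc.
Qed.

Lemma spanner_S c v : spanner (st c.+1 v) =
  if spanner (st c v) is Some f then Some f else out (base (st c.+1 v)).
Proof. by []. Qed.

Lemma spanner_upto c v : c <= r n ->
  match spanner (st c v) with
  | Some o => @outputs _ _ (gossip_run B) (forget_input N) v o
  | None => forall t, t <= c -> @gossip_run _ _ B (forget_input N) v t = None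
  end.
Proof.
elim: c => [|c IH] cr.
  rewrite /=; case E: (out _) => [o|]; first by exists 0.
  by move=> t; rewrite leqn0 => /eqP->.
rewrite spanner_S base_st //; move: {IH}(IH (ltnW cr)).
case: (spanner _) => // noout; case E: (out _) => [o|].
  by exists c.+1 => // t; exact: noout.
by move=> t; rewrite leq_eqVlt => /predU1P[->//|]; exact: noout.
Qed.

Lemma spanner_st c v : r n <= c ->
  exists2 f, spanner (st c v) = Some f & forall u, f (uid u) = s v u.
Proof.
move=> /subnKC <-; elim: (c - r n) => [|j [f Ef fs]]; last first.
  by exists f => //; rewrite addnS spanner_S Ef.
rewrite addn0; have := spanner_upto v (leqnn (r n)).
case: (spanner _) => [f|noout]; last by have [t /noout ->] := B_rounds v.
by have [o out_o os] := B_spanner v => /(outputs_uniq out_o) <-; exists o.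
Qed.

(** * Growth of knowledge and settling *)

Lemma known_S c v w : known (st c.+1 v) w <->
  known (st c v) w \/ exists2 u, comm c v u & known (st c u) w.
Proof.
rewrite {1}/st execS /=; split=> [[|[i [x [Ex kw]]]]|[|[u vu kw]]].
- by left.
- right; have [u [vu _ Ex']] := inbox_Some (A := F) Ex.
  by exists u => //; move: kw; rewrite Ex'.
- by left.
right; exists (uid u), (send (st c u) (uid v)); split=> //.
exact: (inbox_comm (A := F)).
Qed.

Lemma settled_S c v i : settled (st c.+1 v) i =
  settled (st c v) i || [exists u, [&& comm c v u, uid u == i & targets (st c u)]].
Proof.
rewrite {1}/st execS /=; congr (_ || _); apply/idP/existsP.
  case E: (inbox _ _ _ _) => [x|//] /=.
  have [u [vu ui ->]] := inbox_Some (A := F) E => /= tu.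
  by exists u; apply/and3P; rewrite ui.
by move=> [u /and3P[vu /eqP <- tu]]; rewrite (inbox_comm (A := F) vu).
Qed.

Let pending c v := [seq i <- view_nbrs (initial_view v) |
  oapp (fun f => f i) false (spanner (st c v)) && ~~ settled (st c.+1 v) i].

Lemma targets_S c v : targets (st c.+1 v) =
  if targets (st c v) is Some l then Some l else
  if (r n <= c) && (size (pending c v) <= K n) then Some (pending c v) else None.
Proof.
by rewrite {1}/st execS /= -/st self_st clock_st.
Qed.

Lemma known_mono c c' v w : c <= c' -> known (st c v) w -> known (st c' v) w.
Proof.
move=> /subnKC <-; elim: (c' - c) => [|j IH] kw; first by rewrite addn0.
by rewrite addnS known_S; left; exact: IH.
Qed.

Lemma settled_mono c c' v i : c <= c' ->
  settled (st c v) i -> settled (st c' v) i.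
Proof.
move=> /subnKC <-; elim: (c' - c) => [|j IH] kw; first by rewrite addn0.
by rewrite addnS settled_S IH.
Qed.

Lemma targets_mono c c' v l : c <= c' ->
  targets (st c v) = Some l -> targets (st c' v) = Some l.
Proof.
move=> /subnKC <-; elim: (c' - c) => [|j IH] kw; first by rewrite addn0.
by rewrite addnS targets_S IH.
Qed.

Lemma known_self c v : known (st c v) (initial_view v).
Proof. by apply: (@known_mono 0). Qed.

Lemma known_consistent c v : consistent (known (st c v)) N.
Proof.
elim: c v => [|c IH] v w; first by move=> ->; exists v.
by rewrite known_S => -[/IH//|[u _ /IH]].
Qed.

(** Messages carry the status at the start of a round, so news of settling is at least one round
    old. This delay gives the strict order behind [targets_cover]. *)
Lemma settled_targets c v u : settled (st c v) (uid u) -> targets (st c.-1 u).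
Proof.
elim: c => [//|c IH]; rewrite settled_S => /orP[/IH|/existsP[x]].
  case E: (targets _) => [l|//] _; by rewrite (targets_mono (leq_pred c) E).
by move=> /and3P[_ /eqP/uid_inj <-].
Qed.

Lemma targets_bounds c v l : targets (st c v) = Some l ->
  r n <= c /\ size l <= K n.
Proof.
elim: c l => [//|c IH] l; rewrite targets_S.
case E: (targets _) => [l'|]; first by move=> -[<-]; have [/leqW] := IH l' E.
by case: ifP => // /andP[/leqW rc sz] [<-].
Qed.

(** * Regular use of spanner edges *)

Lemma mem_pending c v u : r n <= c ->
  (uid u \in pending c v) = s v u && ~~ settled (st c.+1 v) (uid u).
Proof.
move=> rc; rewrite mem_filter andbC andbA; congr (_ && _).
have [f -> fs] := spanner_st v rc; rewrite /= fs.
have [svu|] := boolP (s v u); last by rewrite andbF.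
by rewrite andbT; apply/mem_view_nbrs; exists u => //; exact: s_link.
Qed.

(* If [u] settles without targeting [v], it knows that [v] settled strictly
   before, and this cannot happen in both directions. *)
Lemma targets_cover c u v l : s u v -> targets (st c u) = Some l ->
  uid v \in l \/ exists2 l', targets (st c v) = Some l' & uid u \in l'.
Proof.
elim: c u v l => [//|c IH] u v l suv; rewrite targets_S.
case E: (targets _) => [l0|].
  move=> [<-]; have [|[l' El' ul']] := IH _ _ _ suv E; first by left.
  by right; exists l' => //; exact: targets_mono (leqnSn c) El'.
case: ifP => // /andP[rc _] [<-]; rewrite mem_pending // suv andTb.
have [sv|_] := boolP (settled _ _); last by left.
(* Here [v] settled before [u]. By induction [v] targets [u], since the alternative has [u] settled
   already at [c]. *)
right; have /= := settled_targets sv; case E': (targets (st c v)) => [l'|//] _.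
have [ul'|[l'' E'']] := IH _ _ _ (etrans (s_sym v u) suv) E'.
  by exists l' => //; exact: targets_mono (leqnSn c) E'.
by rewrite E in E''.
Qed.

(** Any [K n] consecutive rounds run through all residues, among them the position of [v] in [l]. *)
Lemma exchange_target c u v l : s u v -> targets (st c u) = Some l ->
  uid v \in l -> exists2 c', c <= c' < c + K n & comm c' u v.
Proof.
move=> suv Eu vl; have [rc szl] := targets_bounds Eu.
have jl : index (uid v) l < size l by rewrite index_mem.
set j := index _ _ in jl; have jK : j < K n := leq_trans jl szl.
have K0 : 0 < K n by exact: leq_ltn_trans jK.
(* The least shift that brings the cyclic counter to [j]; the summand [K n] keeps the subtraction
   from truncating. *)
set c' := c + (j + K n - (c - r n) %% K n) %% K n.
have c'K : c <= c' < c + K n by rewrite leq_addr ltn_add2l ltn_pmod.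
exists c' => //.
have cj : (c' - r n) %% K n = j.
  have xK := ltn_pmod (c - r n) K0.
  rewrite /c' -addnBAC // modnDmr [in X in (X + _) %% _](divn_eq (c - r n) (K n)).
  rewrite -addnA subnKC; last by rewrite (leq_trans (ltnW xK)) // leq_addl.
  by rewrite modnMDl modnDr modn_small.
rewrite /comm /gossip_comm s_link // andTb contact_st.
have /andP[cc' _] := c'K; rewrite ltnNge (leq_trans rc cc') /= cj.
by rewrite (targets_mono cc' Eu) /= onthE (nth_map (uid v)) // nth_index // eqxx.
Qed.

Lemma exchange c u v : s u v -> targets (st c u) ->
  exists2 c', c <= c' < c + K n & comm c' u v.
Proof.
move=> suv; case E: (targets _) => [l|//] _.
have [|[l' E' ul']] := targets_cover suv E; first exact: exchange_target E.
have [|c' cc' vu] := exchange_target _ E' ul'; first by rewrite s_sym.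
by exists c' => //; rewrite comm_sym.
Qed.

(** * Halving of the unsettled nodes *)

Let unsettled c := [set v | ~~ targets (st c v)].

(** A node still unsettled at the end saw more than [K n] pending neighbors in the last round of the
    window. Had one of them been settled at [c], an exchange within the window would have reported
    it. So the node has high degree inside [unsettled c]. *)
Lemma unsettled_half c : 0 < K n -> r n <= c ->
  2 * #|unsettled (c + K n)| <= #|unsettled c|.
Proof.
move=> K0 rc; apply: leq_trans (few_high_degree (unsettled c) s_density).
rewrite leq_mul2l /=; apply/subset_leq_card/subsetP => v; rewrite !inE => Uv.
have Uvc : ~~ targets (st c v).
  apply: contra Uv; case E: (targets _) => [l|//] _.
  by rewrite (targets_mono (leq_addr _ _) E).
(* The last round of the window is split off: there the node declined to settle. *)
rewrite Uvc /=; move: Uv; rewrite -(prednK K0) addnS targets_S.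
case: (targets _) => //; rewrite (leq_trans rc (leq_addr _ _)) /=.
have [//|Klt _] := leqP (size (pending _ _)) (K n); apply: leq_trans Klt _.
set U := [set u in _ | _]; rewrite cardE -(size_map (@uid I N)).
apply: uniq_leq_size.
  by rewrite filter_uniq // sort_uniq (map_inj_uniq (@uid_inj I N)) enum_uniq.
move=> i ip; have [u _ ui] : exists2 u, link v u & uid u = i.
  by apply/mem_view_nbrs; move: ip; rewrite mem_filter => /andP[].
move: ip; rewrite -ui mem_pending ?(leq_trans rc (leq_addr _ _)) //.
move=> /andP[svu nset]; apply: map_f; rewrite mem_enum !inE svu andbT.
apply: contra nset => tu.
have [c' /andP[cc' c'K] uv] := exchange (etrans (s_sym u v) svu) tu.
apply: (@settled_mono c'.+1).
  by rewrite -addnS prednK.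
rewrite settled_S; apply/orP; right; apply/existsP; exists u.
rewrite comm_sym uv eqxx /=.
by case E: (targets _) tu => [l|//]; rewrite (targets_mono cc' E).
Qed.

Lemma all_settled j v : 0 < K n -> n < 2 ^ j -> targets (st (r n + K n * j) v).
Proof.
move=> K0 nj.
have le_n i : 2 ^ i * #|unsettled (r n + K n * i)| <= n.
  elim: i => [|i IH]; first by rewrite mul1n max_card.
  apply: leq_trans IH; rewrite expnSr -mulnA leq_mul2l mulnSr addnA.
  by rewrite unsettled_half ?orbT // leq_addr.
have /eqP : #|unsettled (r n + K n * j)| = 0.
  apply/eqP; rewrite -leqn0 leqNgt; apply/negP => U0.
  by have := le_n j; rewrite leqNgt (leq_trans nj) // leq_pmulr.
rewrite cards_eq0 => /eqP/setP/(_ v); rewrite !inE.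
by case: (targets _).
Qed.

(** * Flooding along spanner walks *)

(** Induction along the walk: the view of [u] first reaches the next node [x], and the edge from [v]
    to [x] is used within [K n] further rounds. *)
Lemma flood j c v u k : n < 2 ^ j -> walk s v u k ->
  r n + K n * j + K n * k <= c -> known (st c v) (initial_view u).
Proof.
move=> nj [p [sp pu pk]] le_c; apply: (known_mono le_c) => {c le_c}.
elim: p v k sp pu pk => [|x p IH] v k /=.
  by move=> _ -> _; exact: known_self.
move=> /andP[svx sp] pu <-.
(* Density 0 would exclude the edge from [v] to [x]. *)
have K0 : 0 < K n.
  rewrite /K muln_gt0 /=; apply: contraTT svx; rewrite -eqn0Ngt => /eqP d0.
  have := hereditary_densityP [set: N] s_density; rewrite d0 leqn0 cards_eq0.
  move=> /eqP/setP/(_ [set v; x]).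
  rewrite in_set0 => /negbT; apply: contra => svx.
  by apply/imsetP; exists (v, x) => //; rewrite !inE.
set c := r n + K n * j + K n * size p.
have tv : targets (st c v).
  have := all_settled v K0 nj; case E: (targets _) => [l|//] _.
  by rewrite (targets_mono _ E) // leq_addr.
have [c' /andP[cc' c'K] vx] := exchange svx tv.
apply: (@known_mono c'.+1); first by rewrite mulnS [K n + _]addnC addnA.
rewrite known_S; right; exists x => //; apply: (known_mono cc').
exact: IH.
Qed.

Lemma sim_runE (v : N) c :
  gossip_run F v c = known_output A (known (st c v)) (uid v).
Proof. by rewrite /gossip_run /= self_st. Qed.

Lemma sim_sound (v : N) c o :
  gossip_run F v c = Some o -> outputs (local_run A) v o.
Proof.
by rewrite sim_runE; apply: known_output_sound; exact: known_consistent.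
Qed.

Lemma sim_complete (v : N) t o j m : n < 2 ^ j ->
  (forall u k, walk (@link I N) v u k -> k <= t ->
    exists2 k', walk s v u k' & k' <= m) ->
  local_run A v t = Some o ->
  gossip_run F v (r n + K n * j + K n * m).
Proof.
move=> nj stretch run; rewrite sim_runE; apply: known_output_complete run _.
move=> u k w kt; have [k' w' k'm] := stretch u k w kt.
by apply: flood nj w' _; rewrite leq_add2l leq_mul2l k'm orbT.
Qed.

End Run.

(* Imported only here: classical_sets shadows the notations of finset. *)
From mathcomp Require Import all_classical all_reals all_analysis.
From mathcomp Require Import ring lra.
Import Order.TTheory GRing.Theory Num.Theory.
Import numFieldNormedType.Exports.
Local Open Scope classical_set_scope.
Local Open Scope ring_scope.

(** * Distances and logarithms *)

(** Balls are described by walks but the stretch by exact distances; this passes from the former to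
    the latter. *)
Lemma walk_distance (V : finType) (e : rel V) x y k : walk e x y k ->
  exists2 d, (d <= k)%N & at_distance e x y d.
Proof.
move=> w; have exw : exists d, `[< walk e x y d >] by exists k; apply/asboolP.
case: (ex_minnP exw) => d /asboolP wd mind; exists d.
  by apply: mind; apply/asboolP.
by split=> // j wj; apply: mind; apply/asboolP.
Qed.

(** The factor 2 absorbs the successor, because [ln 2 <= ln n]. *)
Lemma trunc_log2_le_ln (R : realType) n : (2 <= n)%N ->
  (trunc_log 2 n).+1%:R <= 2 / ln 2 * ln n%:R :> R.
Proof.
move=> n2; have n0 : (0 < n)%N by apply: leq_trans n2.
have ln2 : 0 < ln 2 :> R by rewrite ln_gt0 // ltr1n.
have le_ln : (trunc_log 2 n)%:R * ln 2 <= ln n%:R :> R.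
  rewrite mulr_natl -lnXn // -natrX ler_ln ?posrE ?ltr0n ?expn_gt0 //.
  by rewrite ler_nat trunc_logP.
have ln_le : ln 2 <= ln n%:R :> R by rewrite ler_ln ?posrE ?ltr0n // ler_nat.
rewrite mulrAC ler_pdivlMr // -natr1; lra.
Qed.

(** * Assembly of the simulator and its round bound *)

Theorem theorem7 (R : realType)
    (alpha beta alpha' beta' T : nat -> R) (delta : nat -> nat)
    (alpha_ge0 : forall n, 0 <= alpha n) (beta_ge0 : forall n, 0 <= beta n)
    (alpha'_ge0 : forall n, 0 <= alpha' n) (beta'_ge0 : forall n, 0 <= beta' n)
    (T_ge0 : forall n, 0 <= T n)
    (Sp : local_algorithm unit (nat -> bool))
    (Sp_spanner : computes_spanner alpha beta delta Sp)
    (Sp_rounds : takes_bigO_rounds (local_run Sp) T)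
    (F' : forall I O : Type, local_algorithm I O -> gossip_algorithm I O)
    (F'_simulator : simulator alpha' beta' F') :
  exists F : forall I O : Type, local_algorithm I O -> gossip_algorithm I O,
    simulator (fun n => alpha n * (delta n)%:R)
      (fun n => T n * alpha' n + beta' n + (delta n)%:R * ln n%:R
                + (delta n)%:R * beta n) F.
Proof.
have [same rounds] := F'_simulator _ _ Sp.
have [r r_O r_rounds] := rounds T T_ge0 Sp_rounds.
pose F I O (A : local_algorithm I O) :=
  sim (F' _ _ Sp) r (fun n => 4 * delta n)%N A.
(* The summands are the spanner phase, enough halving windows for [n] to lie below the power of 2,
   and flooding up to the stretched radius. *)
pose bound t n := (r n + 4 * delta n * (trunc_log 2 n).+1 +
  4 * delta n * Num.truncn (alpha n * t%:R + beta n))%N.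
have sound I O (A : local_algorithm I O) (N : network I) (v : N) t o :
  gossip_run (F I O A) v t = Some o -> outputs (local_run A) v o.
  exact: sim_sound.
have complete I O (A : local_algorithm I O) (N : network I) (v : N) t :
  local_run A v t -> gossip_run (F I O A) v (bound t #|N|).
  case run: (local_run A v t) => [y|] // _.
  have [s [s_out [[s_sym s_link] s_stretch] s_density]] :=
    Sp_spanner (forget_input N).
  apply: (@sim_complete _ r delta I O A N s s_sym s_link s_density) run => //.
  - by move=> u; have [f out_f fs] := s_out u; exists f => //; apply/same.
  - by move=> u; exact: (r_rounds (forget_input N)).
  - exact: trunc_log_ltn.
  (* Walk lengths are integers, so truncating the real stretch bound loses nothing. *)
  move=> u k /walk_distance[d dk] /s_stretch[k' [w _] k'_le] kt; exists k' => //.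
  rewrite truncn_ge_nat ?addr_ge0 ?mulr_ge0 // (le_trans k'_le) // lerD2r.
  by rewrite ler_wpM2l // ler_nat (leq_trans dk).
exists F => I O A; split=> [N v o|U U_ge0 [rA rA_O rA_rounds]].
  split=> [out_o|[t run _]]; last exact: (sound _ _ _ _ _ _ _ run).
  (* Completeness yields some output of the simulation; soundness and uniqueness of LOCAL outputs
     identify it with [o]. *)
  have [t run _] := out_o.
  have [|y out_y [t' _ run']] :=
    @outputs_ex _ _ (gossip_run (F I O A)) N v (bound t #|N|).
    by apply: complete; rewrite run.
  by rewrite (outputs_uniq out_o (sound _ _ _ _ _ _ _ run')).
exists (fun n => bound (rA n) n); last first.
  move=> N v; have [t t_le run] := rA_rounds N v.
  exists (bound t #|N|); last exact: complete.
  rewrite leq_add2l leq_mul2l le_truncn ?orbT // lerD2r ler_wpM2l //.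
  by rewrite ler_nat.
have /eqO_exP[c1 c1_gt0 r_le] := r_O; have /eqO_exP[c2 c2_gt0 rA_le] := rA_O.
have ln2 : 0 < ln 2 :> R by rewrite ln_gt0 // ltr1n.
have c3_gt0 : 0 < 2 / ln 2 :> R by rewrite divr_gt0.
(* The four summands pay for the spanner phase, the logarithm, and the [alpha] and [beta] parts of
   the flooding. *)
apply/eqO_exP; exists (c1 + 4 * (2 / ln 2) + 4 * c2 + 4).
  lra.
near=> n.
(* At [n = 1] the logarithm vanishes and cannot bound the number of windows. *)
have n2 : (2 <= n)%N by near: n; exact: nbhs_infty_ge.
have ln_ge : 0 <= ln n%:R :> R by rewrite ln_ge0 // ler1n ltnW.
have d_ge : 0 <= (delta n)%:R :> R by exact: ler0n.
have : `|(r n)%:R| <= c1 * `|alpha' n * T n + beta' n| by near: n.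
have : `|(rA n)%:R| <= c2 * `|U n| by near: n.
have x_ge : 0 <= alpha' n * T n + beta' n by rewrite addr_ge0 ?mulr_ge0.
rewrite !ger0_norm ?addr_ge0 ?mulr_ge0 // => rA_U r_T.
have tr_le : (Num.truncn (alpha n * (rA n)%:R + beta n))%:R <=
    alpha n * (c2 * U n) + beta n.
  rewrite (le_trans (_ : _ <= alpha n * (rA n)%:R + beta n)) //.
    by rewrite truncn_le addr_ge0 ?mulr_ge0.
  by rewrite lerD2r ler_wpM2l.
have log_le := trunc_log2_le_ln R n2.
rewrite /bound !natrD !natrM.
have {}tr_le := ler_wpM2l d_ge tr_le; have {}log_le := ler_wpM2l d_ge log_le.
have aU_ge0 : 0 <= alpha n * (delta n)%:R * U n by rewrite !mulr_ge0.
have dl_ge0 : 0 <= (delta n)%:R * ln n%:R :> R by rewrite mulr_ge0.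
have db_ge0 : 0 <= (delta n)%:R * beta n by rewrite mulr_ge0.
set c3 := 2 / ln 2 in c3_gt0 log_le *.
set x := alpha' n * T n + beta' n in x_ge r_T.
set a := alpha n * (delta n)%:R * U n in aU_ge0 *.
set l := (delta n)%:R * ln n%:R in dl_ge0 *.
set b := (delta n)%:R * beta n in db_ge0 *.
have -> : a + (T n * alpha' n + beta' n + l + b) = x + a + l + b.
  by rewrite /x; ring.
have tot : (r n)%:R + 4 * ((delta n)%:R * (trunc_log 2 n).+1%:R) +
    4 * ((delta n)%:R * (Num.truncn (alpha n * (rA n)%:R + beta n))%:R) <=
    c1 * x + 4 * (c3 * l) + 4 * (c2 * a + b).
  have E1 : (delta n)%:R * (c3 * ln n%:R) = c3 * l by rewrite /l; ring.
  have E2 : (delta n)%:R * (alpha n * (c2 * U n) + beta n) = c2 * a + b.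
    by rewrite /a /b; ring.
  rewrite E1 in log_le; rewrite E2 in tr_le; lra.
rewrite -!mulrA; apply: le_trans tot _.
(* The surplus on the right is a sum of nonnegative products, which linear arithmetic treats as
   atoms. *)
have := mulr_ge0 (ltW c1_gt0) aU_ge0; have := mulr_ge0 (ltW c1_gt0) dl_ge0.
have := mulr_ge0 (ltW c1_gt0) db_ge0; have := mulr_ge0 (ltW c2_gt0) x_ge.
have := mulr_ge0 (ltW c2_gt0) dl_ge0; have := mulr_ge0 (ltW c2_gt0) db_ge0.
have := mulr_ge0 (ltW c3_gt0) x_ge; have := mulr_ge0 (ltW c3_gt0) aU_ge0.
have := mulr_ge0 (ltW c3_gt0) db_ge0.
lra.
Unshelve. all: by end_near.
Qed.
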